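(* Let $M$ be a real symmetric matrix with finite index set $V(M)$, let $\mathcal{F}\le\mathbb{R}$ be a field containing all entries of $M$, and let $u,v\in V(M)$ be two distinct strongly cospectral indices of $M$. Let $P_+$ and $P_-$ be the minimal polynomials of $M$ relative to $e_u+e_v$ and $e_u-e_v$, respectively, and assume that $P_+$ and $P_-$ are irreducible over $\mathcal{F}$. If $$\frac{\operatorname{Tr}(P_+)}{\deg(P_+)}\neq\frac{\operatorname{Tr}(P_-)}{\deg(P_-)},$$ then there is pretty good state transfer (PGST) from $u$ to $v$ for $M$.
   Context: $e_u$ denotes the characteristic (standard basis) vector of the index $u$. For a vector $z$, the minimal polynomial of $M$ relative to $z$ is the monic polynomial $\rho$ of smallest degree such that $\rho(M)z=0$. When $M$ has entries in $\mathcal{F}$, the polynomials $P_\pm$ have coefficients in $\mathcal{F}$. $\operatorname{Tr}$ of a polynomial denotes the sum of its roots (with multiplicity). Indices $u,v$ are strongly cospectral for $M$ if for every eigenvector $\varphi$ of $M$ one has $\varphi(u)=\varphi(v)$ or $\varphi(u)=-\varphi(v)$. $M$ has PGST from $u$ to $v$ if $\limsup_{t\to\infty}|(e^{itM})(u,v)|=1$. *)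

(* Defs.v *)
From HB Require Import structures.
From mathcomp Require Import all_boot all_order all_algebra.
From mathcomp Require Import all_classical all_reals all_analysis.
From mathcomp Require Import complex.

Set Implicit Arguments.
Unset Strict Implicit.
Unset Printing Implicit Defensive.

Import Order.TTheory GRing.Theory Num.Theory.
Import numFieldNormedType.Exports.

Local Open Scope ring_scope.
Local Open Scope complex_scope.

(* Vectors are columns, and the index set is 'I_n.+1: as it contains u and v it
   is never empty, and horner_mx (evaluation of a polynomial at a matrix) is
   only available for square matrices of manifestly positive size. *)

Definition char_vec (R : realType) (n : nat) (u : 'I_n.+1) : 'cV[R]_n.+1 :=
  delta_mx u 0.

Definition is_eigenvector (R : realType) (n : nat) (M : 'M[R]_n.+1)
    (phi : 'cV[R]_n.+1) : Prop :=
  phi != 0 /\ exists lambda : R, M *m phi = lambda *: phi.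

Definition strongly_cospectral (R : realType) (n : nat) (M : 'M[R]_n.+1)
    (u v : 'I_n.+1) : Prop :=
  forall phi : 'cV[R]_n.+1, is_eigenvector M phi ->
    phi u 0 = phi v 0 \/ phi u 0 = - phi v 0.

Definition is_rel_minpoly (R : realType) (n : nat) (M : 'M[R]_n.+1)
    (z : 'cV[R]_n.+1) (rho : {poly R}) : Prop :=
  [/\ rho \is monic, horner_mx M rho *m z = 0 &
      forall q : {poly R}, q \is monic -> horner_mx M q *m z = 0 ->
        (size rho <= size q)%N].

(* F is a subfield of R with carrier S: its elements are those of S, and the
   inclusion val : F -> R is a ring morphism. *)
Definition irreducible_over (R : realType) (S : {pred R}) (F : subFieldType S)
    (p : {poly R}) : Prop :=
  exists q : {poly F}, p = map_poly (val : F -> R) q /\ irreducible_poly q.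

Definition complex_roots (R : realType) (p : {poly R}) : seq R[i] :=
  sval (closed_field_poly_normal (map_poly (real_complex R) p)).

Definition poly_trace (R : realType) (p : {poly R}) : R[i] :=
  \sum_(z <- complex_roots p) z.

Definition poly_deg (R : realType) (p : {poly R}) : nat := (size p).-1.

(* The series of the A ^+ k / k! is summed entry by entry. *)
Definition expmx (K : numFieldType) (n : nat) (A : 'M[K]_n.+1) : 'M[K]_n.+1 :=
  \matrix_(i, j) limn (series (fun k : nat => (A ^+ k) i j / k`!%:R)).

Definition transition_mx (R : realType) (n : nat) (M : 'M[R]_n.+1) (t : R) :
    'M[R[i]]_n.+1 :=
  expmx (('i%C * t%:C) *: map_mx (real_complex R) M).

Definition pgst (R : realType) (n : nat) (M : 'M[R]_n.+1) (u v : 'I_n.+1) :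
    Prop :=
  limf_esup (fun t : R => (Normc.normc (transition_mx M t u v))%:E)
            (pinfty_nbhs R) = 1%E.

(* Main.v *)
Require Import Defs.
From HB Require Import structures.
From mathcomp Require Import all_boot all_order all_algebra.
From mathcomp Require Import all_classical all_reals all_analysis.
From mathcomp Require Import complex.
From mathcomp Require Import ring lra mxtens qpoly spectral.

(* In a unitary eigenbasis of M, strong cospectrality gives
   U(t)_{uv} = \sum_r s_r w_r e^{i t d_r} with s_r = 1 or -1, w_r >= 0 and
   \sum_r w_r = 1, where d_r is a root of P_+ or P_- according to s_r as soon as
   w_r > 0.  Each frequency nu of the expansion of U(t)_{uv}^N then collects
   terms of one sign: if d_{f 1} + ... + d_{f N} = d_{g 1} + ... + d_{g N}, all
   the d_r act as multiplications on a finite-dimensional F-space (spanned by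
   the entries of a common eigenvector), where the trace of the action of d_r
   is proportional to the mean of the roots of its irreducible polynomial; as
   the two means differ, f and g hit equally many roots of P_-.  By pigeonhole
   one frequency has a coefficient of modulus at least (N+1)^-(n+1), and a
   coefficient of an exponential sum is bounded by its supremum over t > A;
   so |U(t)_{uv}| cannot stay below some r < 1 for all t > A. *)

Set Implicit Arguments.
Unset Strict Implicit.
Unset Printing Implicit Defensive.

Import Order.TTheory GRing.Theory Num.Theory.
Import numFieldNormedType.Exports.

Local Open Scope ring_scope.
Local Open Scope complex_scope.

(** * Matrices over a field that share an eigenvector over an extension, and their traces *)

(** Tensoring eigenvectors, one for each element of [ds], gives [e]; [M] on one factor and the
    identity on the others scale it by the eigenvalue of that factor. *)
Lemma common_eigenvector_tensor (F C : fieldType) (iota : {rmorphism F -> C})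
    (n : nat) (M : 'M[F]_n) (ds : seq C) :
  all (eigenvalue (map_mx iota M)) ds ->
  exists m (e : 'rV[C]_m), e != 0 /\
    {in ds, forall d, exists A : 'M[F]_m, e *m map_mx iota A = d *: e}.
Proof.
elim: ds => [_|d ds IH /= /andP[/eigenvalueP[w wM w0] /IH[m [e [e0 eA]]]]].
  by exists 1%N, 1%:M; split=> //; exact: oner_neq0.
exists (m * n)%N, (e *t w); split=> [|x].
  have /rV0Pn[i ei] := e0; have /rV0Pn[j wj] := w0.
  apply/rV0Pn; exists (mxtens_index (i, j)).
  by rewrite mxE mxtens_indexK mulf_neq0 //= ord1.
rewrite in_cons => /predU1P[->|/eA[A eAx]].
  exists (1%:M *t M); rewrite map_mxT; etransitivity.
    exact: (tensmx_mul e w (map_mx iota 1%:M) (map_mx iota M)).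
  by rewrite wM map_mx1 mulmx1; apply/matrixP=> i j; rewrite !mxE mulrCA.
exists (A *t 1%:M); rewrite map_mxT; etransitivity.
  exact: (tensmx_mul e w (map_mx iota A) (map_mx iota 1%:M)).
by rewrite eAx map_mx1 mulmx1; apply/matrixP=> i j; rewrite !mxE mulrA.
Qed.

(* A linear dependence among the entries of e expresses one of them through
   the others, and deleting it compresses the matrices acting on e. *)
Lemma common_eigenvector_free (F C : fieldType) (iota : {rmorphism F -> C})
    (ds : {pred C}) (m : nat) (e : 'rV[C]_m) :
  e != 0 ->
  {in ds, forall d, exists A : 'M[F]_m, e *m map_mx iota A = d *: e} ->
  exists m' (e' : 'rV[C]_m'), [/\ e' != 0,
    forall c : 'cV[F]_m', e' *m map_mx iota c = 0 -> c = 0 &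
    {in ds, forall d, exists A : 'M[F]_m', e' *m map_mx iota A = d *: e'}].
Proof.
elim: m e => [|m IH] e e0 eA; first by rewrite thinmx0 eqxx in e0.
have [ker0|/existsNP[c /not_implyP[ec0 /eqP c0]]] := pselect
    (forall c : 'cV[F]_m.+1, e *m map_mx iota c = 0 -> c = 0).
  by exists m.+1, e.
have /cV0Pn[j cj0] := c0.
(* [T] deletes the entry [j] of [e], and [L] restores it as the combination of the other entries
   dictated by [c]. *)
pose L : 'M[F]_(m, m.+1) := \matrix_(i, k)
  (if k == j then - (c (lift j i) 0 / c j 0) else (k == lift j i)%:R).
pose T : 'M[F]_(m.+1, m) := \matrix_(i, k) (i == lift j k)%:R.
have eT : e *m map_mx iota T = \row_k e 0 (lift j k).
  apply/rowP=> k; rewrite !mxE (bigD1 (lift j k)) //= !mxE eqxx rmorph1 mulr1.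
  by rewrite big1 ?addr0 // => i /negPf ik; rewrite !mxE ik rmorph0 mulr0.
have eTL : e *m map_mx iota T *m map_mx iota L = e.
  rewrite eT; apply/rowP=> k; rewrite !mxE.
  have icj0 : iota (c j 0) != 0 by rewrite fmorph_eq0.
  have [k' ->|->] := unliftP j k; last first.
    have /rowP/(_ 0) := ec0; rewrite !mxE (bigD1_ord j) //= !mxE => ecj.
    apply: (mulIf icj0); move/eqP: ecj; rewrite addr_eq0 => /eqP ->.
    rewrite mulr_suml -sumrN; apply: eq_bigr => i _; rewrite !mxE eqxx.
    by rewrite rmorphN fmorph_div mulrN mulNr mulrA divfK.
  rewrite (bigD1 k') //= !mxE eqxx [lift j k' == j]eq_sym (negPf (neq_lift _ _)).
  rewrite rmorph1 mulr1 big1 ?addr0 // => i ik; rewrite !mxE.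
  rewrite [lift j k' == j]eq_sym (negPf (neq_lift _ _)).
  by rewrite (inj_eq lift_inj) eq_sym (negPf ik) rmorph0 mulr0.
apply: (IH (e *m map_mx iota T)).
  by apply: contra_neq e0 => eT0; rewrite -eTL eT0 mul0mx.
move=> d /eA[A eAd]; exists (L *m A *m T).
by rewrite !map_mxM !mulmxA eTL eAd -scalemxAl.
Qed.

Lemma mulmx_horner_eigen (K : fieldType) (n : nat) (A : 'M[K]_n.+1)
    (e : 'rV[K]_n.+1) (a : K) (p : {poly K}) :
  e *m A = a *: e -> e *m horner_mx A p = p.[a] *: e.
Proof.
move=> eA; elim/poly_ind: p => [|p c IH].
  by rewrite rmorph0 mulmx0 horner0 scale0r.
rewrite rmorphD rmorphM /= horner_mx_X horner_mx_C mulmxDr mulmxA IH.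
by rewrite -scalemxAl eA scalerA mul_mx_scalar -scalerDl hornerMXaddC.
Qed.

(** A nonconstant [p] has a root in the algebraically closed field and shares it with [q], so the
    two are not coprime and the irreducible [q] divides [p]; the quotient is handled by induction on
    the degree. *)
Lemma monic_power_of_irreducible (F : fieldType) (C : closedFieldType)
    (iota : {rmorphism F -> C}) (p q : {poly F}) :
  p \is monic -> q \is monic -> irreducible_poly q ->
  (forall z, root (map_poly iota p) z -> root (map_poly iota q) z) ->
  exists k, p = q ^+ k.
Proof.
move=> pm qm qirr; have [N] := ubnP (size p).
elim: N => // N IH in p pm *; rewrite ltnS => sp rpq.
have [p1|p1] := eqVneq (size p) 1%N.
  exists 0%N; have /size_poly1P[c c0 pE] : size p == 1%N by rewrite p1.
  by move: pm; rewrite pE monicE lead_coefC => /eqP->.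
have [z pz] : exists z, root (map_poly iota p) z.
  by apply/closed_rootP; rewrite size_map_poly.
have : q %| p.
  rewrite -[_ %| _]negbK -(irreducible_poly_coprime _ qirr) -(coprimep_map iota).
  by apply/negP => /coprimep_root/(_ (rpq z pz)); rewrite -[_ != 0]/(~~ root _ _) pz.
case/dvdpP=> p' pE.
have p'm : p' \is monic by rewrite pE monicMr in pm.
have [||k p'k] := IH p' p'm.
- apply: leq_trans sp; rewrite pE size_monicM ?monic_neq0 //.
  by case: qirr => + _; case: (size q) => [|[|s]] // _; rewrite !addnS ltnS leq_addr.
- by move=> w p'w; apply: rpq; rewrite pE rmorphM rootM p'w.
by exists k.+1; rewrite pE p'k exprSr.
Qed.

(** The characteristic polynomial is a power [q ^+ k], so its roots are [rs] repeated k times: both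
    the trace and the dimension pick up the factor k. *)
Lemma mxtrace_irreducible (F : fieldType) (C : closedFieldType)
    (iota : {rmorphism F -> C}) (n : nat) (A : 'M[F]_n) (q : {poly F})
    (rs : seq C) :
  q \is monic -> irreducible_poly q ->
  map_poly iota q = \prod_(z <- rs) ('X - z%:P) ->
  (forall z, root (map_poly iota (char_poly A)) z -> root (map_poly iota q) z) ->
  iota (\tr A) * (size rs)%:R = n%:R * \sum_(z <- rs) z.
Proof.
(* The empty matrix is set apart because the trace is read off the coefficient of index [n.-1]. *)
move=> qm qirr qrs Aq; have [n0|n0] := posnP n.
  by rewrite n0 mul0r in A Aq *; rewrite thinmx0 mxtrace0 rmorph0 mul0r.
have [k pk] := monic_power_of_irreducible (char_poly_monic A) qm qirr Aq.
have pks : map_poly iota (char_poly A) =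
    \prod_(z <- flatten (nseq k rs)) ('X - z%:P).
  rewrite pk rmorphXn /= qrs; elim: k {pk} => [|k IHk].
    by rewrite expr0 big_nil.
  by rewrite exprS IHk big_cat.
have szk : size (flatten (nseq k rs)) = (k * size rs)%N.
  by rewrite size_flatten /shape map_nseq sumn_nseq mulnC.
have nE : n = (k * size rs)%N.
  have := congr1 (fun p : {poly C} => size p) pks.
  by rewrite size_map_poly size_char_poly size_prod_XsubC szk => -[].
have sumk : \sum_(z <- flatten (nseq k rs)) z = k%:R * \sum_(z <- rs) z.
  elim: k {pk pks szk nE} => [|k IHk]; first by rewrite big_nil mul0r.
  by rewrite big_cat IHk mulrSr mulrDl mul1r addrC.
have := @coefPn_prod_XsubC _ (flatten (nseq k rs)).
rewrite szk -nE -pks coef_map char_poly_trace // -lt0n.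
move=> /(_ n0); rewrite raddfN => /oppr_inj ->.
by rewrite sumk [in RHS]nE natrM mulrAC.
Qed.

(** The relation among the [d i] passes to the matrices over [F] acting by them on a free common
    eigenvector, as this action is faithful. Traces are then compared: the normalized trace of a
    matrix annihilated by [q i] is the mean of the roots of [q i]. *)
Lemma eigenvalue_sum_mean (F : fieldType) (C : numClosedFieldType)
    (iota : {rmorphism F -> C}) (n : nat) (M : 'M[F]_n) (I : finType)
    (d : I -> C) (q : I -> {poly F}) (rs : I -> seq C) :
  (forall i, eigenvalue (map_mx iota M) (d i)) ->
  (forall i, q i \is monic /\ irreducible_poly (q i)) ->
  (forall i, root (map_poly iota (q i)) (d i)) ->
  (forall i, map_poly iota (q i) = \prod_(z <- rs i) ('X - z%:P)) ->
  forall (J : finType) (f g : J -> I),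
  \sum_j d (f j) = \sum_j d (g j) ->
  \sum_j (\sum_(z <- rs (f j)) z) / (size (rs (f j)))%:R =
  \sum_j (\sum_(z <- rs (g j)) z) / (size (rs (g j)))%:R.
Proof.
move=> dM qmi dq qrs J f g dfg.
have [m0 [e0 [e0N0 e0A]]] : exists m (e : 'rV[C]_m), e != 0 /\
    {in codom d, forall c, exists A : 'M[F]_m, e *m map_mx iota A = c *: e}.
  apply: (@common_eigenvector_tensor _ _ _ _ M).
  by apply/allP => _ /codomP[i ->].
have [m [e [eN0 eI eA]]] := common_eigenvector_free e0N0 e0A.
case: m e eN0 eI eA => [|m] e; first by rewrite thinmx0 eqxx.
move=> eN0 eI /= eA.
have eM (A : 'M[F]_m.+1) : e *m map_mx iota A = 0 -> A = 0.
  move=> eA0; apply/matrixP=> i j; rewrite mxE.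
  have /eI/colP/(_ i) : e *m map_mx iota (col j A) = 0.
    by rewrite map_col colE mulmxA eA0 mul0mx.
  by rewrite !mxE.
have {eA} [A eA] : exists A : I -> 'M[F]_m.+1,
    forall i, e *m map_mx iota (A i) = d i *: e.
  apply: (@fin_all_exists I (fun=> 'M[F]_m.+1)
    (fun i A => e *m map_mx iota A = d i *: e)) => i.
  by apply: eA; exact: codom_f.
have qA i : horner_mx (A i) (q i) = 0.
  apply: eM; rewrite map_horner_mx (mulmx_horner_eigen _ (eA i)).
  by move/rootP: (dq i) => ->; rewrite scale0r.
have trA i : iota (\tr (A i)) / m.+1%:R = (\sum_(z <- rs i) z) / (size (rs i))%:R.
  have [qm qirr] := qmi i.
  have rs0 : (size (rs i))%:R != 0 :> C.
    rewrite pnatr_eq0; case: qirr => + _.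
    by rewrite -(size_map_poly iota) qrs size_prod_XsubC ltnS -lt0n.
  apply: (mulIf rs0); rewrite divfK // mulrAC.
  rewrite (mxtrace_irreducible qm qirr (qrs i)) ?mulKf ?pnatr_eq0 //.
    by rewrite mulrAC divff ?mul1r ?pnatr_eq0.
  (* Characteristic roots are roots of the minimal polynomial, which divides [q i]. *)
  move=> z; rewrite map_char_poly -root_mxminpoly mxminpoly_map.
  apply: root_dvdp; rewrite dvdp_map. apply: mxminpoly_min; exact: qA.
under eq_bigr do rewrite -trA; under [RHS]eq_bigr do rewrite -trA.
rewrite -!mulr_suml; congr (_ / _).
rewrite -!rmorph_sum; congr (iota _); rewrite -!raddf_sum; congr (\tr _).
apply/eqP; rewrite -subr_eq0; apply/eqP/eM.
rewrite map_mxB mulmxBr.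
have eS (h : J -> I) : e *m map_mx iota (\sum_j A (h j)) = (\sum_j d (h j)) *: e.
  rewrite map_mx_sum mulmx_sumr scaler_suml.
  by apply: eq_bigr => j _; apply: eA.
by rewrite !eS dfg subrr.
Qed.

(** * Complex exponentials, and sums of them with real frequencies *)

Definition cis (R : realType) (x : R) : R[i] := cos x +i* sin x.

Lemma cis0 (R : realType) : cis 0 = 1 :> R[i].
Proof. by rewrite /cis cos0 sin0. Qed.

Lemma cisD (R : realType) (x y : R) : cis (x + y) = cis x * cis y.
Proof. by rewrite /cis cosD sinD; simpc; rewrite [sin x * _ + _]addrC. Qed.

Lemma cis_sum (R : realType) (I : finType) (x : I -> R) :
  cis (\sum_i x i) = \prod_i cis (x i).
Proof. exact: (big_morph (@cis R) (@cisD R) (@cis0 R)). Qed.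

Lemma cisMn (R : realType) (x : R) (m : nat) : cis (x *+ m) = cis x ^+ m.
Proof.
by elim: m => [|m IH]; rewrite ?mulr0n ?cis0 // mulrS exprS cisD IH.
Qed.

Lemma norm_cis (R : realType) (x : R) : `|cis x| = 1.
Proof. by rewrite normc_def /= cos2Dsin2 sqrtr1. Qed.

Lemma cis_neq1 (R : realType) (x : R) : x != 0 -> `|x| <= pi -> cis x != 1.
Proof.
move=> x0 xpi; apply: contra x0 => /eqP/(congr1 (@complex.Re R)) /= cx.
rewrite -normr_eq0; apply/eqP/cos_inj; rewrite ?in_itv /= ?normr_ge0 ?xpi //.
  by rewrite lexx pi_ge0.
by rewrite cos0 cos_norm.
Qed.

Local Open Scope classical_set_scope.

Lemma cvg_complex (R : realType) (a b : R ^nat) (x y : R) :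
  a @ \oo --> x -> b @ \oo --> y ->
  (fun n => a n +i* b n : (R[i] : numFieldType)) @ \oo
    --> (x +i* y : (R[i] : numFieldType)).
Proof.
move=> ax bY; apply/cvgrPdist_lt => e e0 /=.
have eR : (complex.Re e)%:C = e by rewrite RRe_real // gtr0_real.
have e0' : 0 < complex.Re e / 2 by rewrite divr_gt0 // -ltcR eR.
near=> n.
have -> : (x +i* y) - (a n +i* b n) = (x - a n)%:C + 'i%C * (y - b n)%:C :> R[i].
  by simpc.
have nC (z : R) : `|z%:C| = `|z|%:C :> R[i].
  by rewrite normc_def /= expr0n addr0 sqrtr_sqr.
apply: le_lt_trans (ler_normD _ _) _.
rewrite normrM complexiE normCi mul1r !nC -rmorphD -eR ltcR.
rewrite [ltRHS]splitr ltrD //; near: n; exact: cvgr_dist_lt.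
Unshelve. all: by end_near. Qed.

Lemma cvg_series_cis (R : realType) (x : R) :
  series (fun k : nat => ('i%C * x%:C) ^+ k / k`!%:R : (R[i] : numFieldType)) @ \oo
    --> (cis x : (R[i] : numFieldType)).
Proof.
rewrite (_ : series _ = (fun n => series (cos_coeff x) n +i* series (sin_coeff x) n)).
  by rewrite /cis unlock; apply: cvg_complex; rewrite ?unlock;
    [exact: is_cvg_series_cos_coeff|exact: is_cvg_series_sin_coeff].
apply/funext => n; rewrite [RHS]complexE /series /= !rmorph_sum mulr_sumr -big_split /=.
apply: eq_bigr => k _; rewrite /cos_coeff /sin_coeff /=.
rewrite exprMn.
(* The parity indicators are those in the coefficients of the cosine and sine series. *)
have -> : 'i%C ^+ k = ((~~ odd k)%:R * (-1) ^ k./2)%:C +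
    'i%C * ((odd k)%:R * (-1) ^+ k.-1./2)%:C :> R[i].
  rewrite -[in LHS](odd_double_half k) exprD -muln2 mulnC exprM sqr_i.
  have [ok|ok] := boolP (odd k); rewrite /= ?mul0r ?mul1r ?rmorph0 ?mulr0.
    rewrite add0r expr1 rmorphXn rmorphN1; congr (_ * _ ^+ _).
    by case: k ok => //= k /negPf ok; rewrite uphalf_half ok.
  by rewrite addr0 exprnP rmorphXn rmorphN1.
by rewrite !rmorphM !fmorphV !rmorph_nat /= -rmorphXn !mulrDl -!mulrA.
Qed.

Local Close Scope classical_set_scope.

(* Averaging over m < T leaves the terms with z = 1 and bounded geometric sums. *)
Lemma power_sum_average (C : numFieldType) (I : finType) (c z : I -> C) (K : C) :
  (forall i, `|z i| = 1) ->
  (forall m, `|\sum_i c i * z i ^+ m| <= K) ->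
  forall T, T%:R * `|\sum_(i | z i == 1) c i| <=
    T%:R * K + \sum_(i | z i != 1) `|c i| * (2 / `|z i - 1|).
Proof.
move=> z1 hK T.
have sumT : \sum_(m < T) \sum_i c i * z i ^+ m =
    T%:R * (\sum_(i | z i == 1) c i) +
    \sum_(i | z i != 1) c i * \sum_(m < T) z i ^+ m.
  rewrite exchange_big /= (bigID (fun i => z i == 1)) /=; congr (_ + _).
    rewrite mulr_sumr; apply: eq_bigr => i /eqP ->.
    by under eq_bigr do rewrite expr1n mulr1; rewrite sumr_const card_ord mulr_natl.
  by apply: eq_bigr => i _; rewrite mulr_sumr.
rewrite -[T%:R in leLHS]normr_nat -normrM.
move/(canRL (addrK _)): (esym sumT) => ->.
apply: le_trans (ler_normB _ _) _; apply: lerD.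
  apply: le_trans (ler_norm_sum _ _ _) _.
  apply: le_trans (ler_sum _ (fun (m : 'I_T) _ => hK m)) _.
  by rewrite sumr_const card_ord mulr_natl.
apply: le_trans (ler_norm_sum _ _ _) _; apply: ler_sum => i zi.
rewrite normrM ler_wpM2l // ler_pdivlMr ?normr_gt0 ?subr_eq0 //.
rewrite -normrM mulrC -subrX1; apply: le_trans (ler_normB _ _) _.
by rewrite normrX z1 expr1n normr1.
Qed.

Lemma bernoulli_ineq (R : realDomainType) (x : R) (n : nat) :
  -1 <= x -> 1 + n%:R * x <= (1 + x) ^+ n.
Proof.
move=> x1; elim: n => [|n IH]; first by rewrite mul0r addr0 expr0.
rewrite exprS; apply: le_trans (ler_wpM2l _ IH); last by lra.
have : 0 <= n%:R * x ^+ 2 by rewrite mulr_ge0 // sqr_ge0.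
by rewrite -natr1; lra.
Qed.

(** Once r <= s^(2(k+1)), the expression is at most (s^(2N) (N+1))^(k+1). Bernoulli's inequality for
    1/s = 1 + h gives s^N (1 + N h) <= 1, and (1 + N h)^2 exceeds N + 1 as soon as N h^2 > 1. *)
Lemma exists_exp_poly_lt1 (R : archiRealFieldType) (r : R) (k : nat) :
  0 <= r < 1 -> exists N : nat, r ^+ N * N.+1%:R ^+ k < 1.
Proof.
move=> /andP[r0 r1].
(* Bernoulli's lower bound for 1 - x raised to the power 2(k+1) is then exactly [r]. *)
pose x : R := (1 - r) / (k.+1 * 2)%:R.
have k2 : (2 : R) <= (k.+1 * 2)%:R by rewrite ler_nat leq_pmull.
have x0 : 0 < x by rewrite divr_gt0 //; lra.
have x1 : x <= 1 / 2 by rewrite ler_pdivrMr; lra.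
pose s := 1 - x; pose h := s^-1 - 1.
have s0 : 0 < s by rewrite /s; lra.
have s1 : s < 1 by rewrite /s; lra.
have h0 : 0 < h by rewrite subr_gt0 invf_gt1.
have rs : r <= (s ^+ 2) ^+ k.+1.
  rewrite -exprM mulnC; apply: le_trans (bernoulli_ineq _ _); last by lra.
  by rewrite mulrN mulrC divfK; lra.
pose N := Num.bound (h ^- 2); exists N.
have Nh : 1 < N%:R * h ^+ 2.
  by rewrite -ltr_pdivrMr ?exprn_gt0 // div1r archi_boundP // invr_ge0 sqr_ge0.
have sN : s ^+ N * (1 + N%:R * h) <= 1.
  have /(ler_wpM2l (exprn_ge0 N (ltW s0))) : 1 + N%:R * h <= (1 + h) ^+ N.
    by apply: bernoulli_ineq; lra.
  by rewrite -exprMn /h addrCA subrr addr0 divff ?expr1n ?gt_eqF.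
have sN2 : (s ^+ 2) ^+ N * N.+1%:R < 1.
  have Nh0 : 0 <= N%:R * h by rewrite mulr_ge0 // ltW.
  have : (s ^+ N * (1 + N%:R * h)) ^+ 2 <= 1.
    by rewrite exprn_ile1 // mulr_ge0 ?exprn_ge0 ?ltW //; lra.
  apply: lt_le_trans; rewrite [ltRHS]exprMn [X in _ < X * _]exprAC.
  rewrite ltr_pM2l ?exprn_gt0 //.
  have N0 : (1 : R) <= N%:R.
    by rewrite ler1n lt0n; apply: contraTneq Nh => ->; rewrite mul0r -leNgt.
  rewrite -natr1; have : 0 < N%:R * h by rewrite mulr_gt0 //; lra.
  have : N%:R * (N%:R * h ^+ 2) > N%:R by rewrite ltr_pMr //; lra.
  by lra.
apply: le_lt_trans (_ : ((s ^+ 2) ^+ N * N.+1%:R) ^+ k.+1 < 1); last first.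
  by rewrite exprn_ilt1 // mulr_ge0 // !exprn_ge0 // ltW.
rewrite [leRHS]exprMn [X in _ <= X * _]exprAC.
apply: ler_pM; rewrite ?exprn_ge0 //; last by rewrite ler_weXn2l ?ler1n.
by rewrite lerXn2r ?nnegrE // exprn_ge0 // sqr_ge0.
Qed.

(** Multiplication by [cis (- x * t)] makes the terms of frequency [x] constant. Averaging over T
    times in arithmetic progression beyond [A] gives [T%:R * (s - K) <= complex.Re D] with [D]
    independent of T, whence s <= K. *)
Lemma exp_sum_coef_le (R : realType) (I : finType) (c : I -> R[i]) (nu : I -> R)
    (A K : R) :
  (forall t, A < t -> `|\sum_i c i * cis (nu i * t)| <= K%:C) ->
  forall x, `|\sum_(i | nu i == x) c i| <= K%:C.
Proof.
move=> hK x.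
(* [B] exceeds every [|nu i - x|], so one step [tau] turns each phase by at most pi and [z i] is 1
   for the frequency [x] only. *)
pose B : R := 1 + \sum_i `|nu i - x|.
have B0 : 0 < B by rewrite ltr_pwDl // sumr_ge0.
pose tau : R := pi / B.
have tau0 : 0 < tau by rewrite divr_gt0 // pi_gt0.
pose z i := cis ((nu i - x) * tau).
have zE i : (z i == 1) = (nu i == x).
  apply/eqP/eqP => [zi1|nux]; last by rewrite /z nux subrr mul0r cis0.
  apply/eqP; rewrite -subr_eq0; apply: contra_eqT zi1 => nux.
  apply: cis_neq1; first by rewrite mulf_neq0 // gt_eqF.
  rewrite normrM (gtr0_norm tau0) /tau mulrA ler_pdivrMr // mulrC.
  rewrite ler_wpM2l ?pi_ge0 // /B (bigD1 i) //= addrCA lerDl.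
  by rewrite addr_ge0 // sumr_ge0.
pose c' i := c i * cis ((nu i - x) * (A + 1)).
have c'K m : `|\sum_i c' i * z i ^+ m| <= K%:C.
  have : A < A + 1 + tau *+ m by rewrite -addrA ltrDl ltr_pwDl // mulrn_wge0 // ltW.
  move/hK; apply: le_trans; rewrite le_eqVlt; apply/orP; left; apply/eqP.
  rewrite -[RHS]mul1r -(norm_cis (- x * (A + 1 + tau *+ m))) -normrM mulr_sumr.
  congr `|_|; apply: eq_bigr => i _; rewrite /c' /z.
  rewrite -cisMn -[LHS]mulrA -cisD [RHS]mulrCA -cisD.
  by congr (_ * cis _); ring.
have S' : \sum_(i | nu i == x) c i = \sum_(i | z i == 1) c' i.
  apply: eq_big => i; first by rewrite zE.
  by move/eqP => nux; rewrite /c' nux subrr mul0r cis0 mulr1.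
have znorm i : `|z i| = 1 by exact: norm_cis.
have avg := power_sum_average znorm c'K.
rewrite -S' in avg; set D := \sum_(i | z i != 1) _ in avg.
have D0 : 0 <= D by apply: sumr_ge0 => i _; apply: mulr_ge0 => //; exact: divr_ge0.
move: avg; rewrite -(RRe_real (ger0_real D0)) (normc_def (\sum_(i | _ i == x) _)).
set s := Num.sqrt _ => avg; rewrite lecR leNgt; apply/negP => Ks.
have {}avg T : T%:R * (s - K) <= complex.Re D.
  rewrite mulrBr lerBlDl.
  by have := avg T; rewrite -!(rmorph_nat (real_complex R)) -!rmorphM -rmorphD lecR.
have D0' : 0 <= complex.Re D by rewrite -lecR (RRe_real (ger0_real D0)).
have sK0 : 0 < s - K by rewrite subr_gt0.
have := avg (Num.bound (complex.Re D / (s - K))).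
by rewrite -ler_pdivlMr // leNgt archi_boundP // divr_ge0 // ltW.
Qed.

(* Expand the N-th power of the sum. By pigeonhole on the numbers of
   occurrences of each index, some frequency collects a total weight at least
   (N+1)^-|I|, without cancellation because its terms share their sign, so the
   N-th power is at least that large somewhere beyond A. *)
Lemma signed_exp_sum_near1 (R : realType) (I : finType) (w d : I -> R)
    (b : I -> bool) :
  (forall i, 0 <= w i) -> \sum_i w i = 1 ->
  (forall N (f g : 'I_N -> I),
    (forall j, 0 < w (f j)) -> (forall j, 0 < w (g j)) ->
    \sum_j d (f j) = \sum_j d (g j) ->
    \prod_j (-1) ^+ b (f j) = \prod_j (-1) ^+ b (g j) :> R) ->
  forall A r : R, r < 1 -> exists2 t, A < t &
    r%:C < `|\sum_i ((-1) ^+ b i * w i)%:C * cis (d i * t)|.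
Proof.
move=> w0 w1 hsgn A r r1; apply: contrapT => /forallPNP hr.
have {}hr t : A < t -> `|\sum_i ((-1) ^+ b i * w i)%:C * cis (d i * t)| <= r%:C.
  by move=> /hr /negP; rewrite normc_def ltcR lecR -leNgt.
have r0 : 0 <= r.
  by have := hr (A + 1); rewrite ltrDl normc_def lecR => /(_ ltr01); apply: le_trans.
have [|N] := @exists_exp_poly_lt1 R r #|I|; first by rewrite r0.
apply/negP; rewrite -leNgt.
pose W (f : {ffun 'I_N -> I}) := \prod_j w (f j).
have W0 f : 0 <= W f by exact: prodr_ge0.
have W1 : \sum_f W f = 1.
  by rewrite -(bigA_distr_bigA (fun=> w)) /= w1 prodr_const expr1n.
pose nu (f : {ffun 'I_N -> I}) := \sum_j d (f j).
pose sg (f : {ffun 'I_N -> I}) : R := \prod_j (-1) ^+ b (f j).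
have coef x : `|\sum_(f | nu f == x) (sg f * W f)%:C| <= (r ^+ N)%:C.
  apply: (@exp_sum_coef_le _ _ (fun f => (sg f * W f)%:C) nu A) => t /hr hrt.
  apply: le_trans (_ : `|\sum_i ((-1) ^+ b i * w i)%:C * cis (d i * t)| ^+ N <= _).
    rewrite -normrX -[in leRHS](card_ord N) -prodr_const.
    rewrite (bigA_distr_bigA (fun=> fun i => ((-1) ^+ b i * w i)%:C * cis (d i * t))).
    rewrite le_eqVlt; apply/orP; left; apply/eqP; congr `|_|.
    apply: eq_bigr => f _; rewrite /= big_split /= -rmorph_prod big_split /=.
    by rewrite /nu mulr_suml cis_sum.
  by rewrite rmorphXn lerXn2r ?nnegrE ?normr_ge0 ?ler0c.
(* A frequency depends only on these counts, and there are (N+1)^|I| possible count functions. No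
   count exceeds [N], so [inord] never takes its default value. *)
pose cnt (f : {ffun 'I_N -> I}) : {ffun I -> 'I_N.+1} :=
  [ffun i => inord #|[set j | f j == i]|].
have nuE f : nu f = \sum_i d i *+ cnt f i.
  rewrite /nu (partition_big f xpredT) //=; apply: eq_bigr => i _.
  rewrite ffunE inordK; last by rewrite ltnS -[leqRHS]card_ord max_card.
  under eq_bigr => j /eqP -> do []; rewrite sumr_const; congr (_ *+ _).
  by apply: eq_card => j; rewrite !inE.
have [a ha] : exists a, 1 <= #|{ffun I -> 'I_N.+1}|%:R * \sum_(f | cnt f == a) W f.
  apply: contrapT => /forallNP ha.
  have : \sum_(a : {ffun I -> 'I_N.+1}) \sum_(f | cnt f == a) W f = 1.
    by rewrite -W1 [RHS](partition_big cnt xpredT).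
  pose m := #|{ffun I -> 'I_N.+1}|.
  move/(congr1 ( *%R m%:R)); rewrite mulr_sumr mulr1.
  apply/eqP; rewrite lt_eqF //.
  rewrite -[ltRHS](sumr_const {ffun I -> 'I_N.+1}).
  apply: ltr_sum => [|a _]; last by move: (ha a) => /negP; rewrite -ltNge.
  by apply/hasP; exists [ffun=> ord0]; rewrite ?mem_index_enum.
have a0 : 0 < \sum_(f | cnt f == a) W f.
  rewrite lt_neqAle sumr_ge0 // andbT eq_sym; apply: contraTneq ha => ->.
  by rewrite mulr0 -ltNge.
have [f0 /eqP f0a Wf0] : exists2 f, cnt f == a & 0 < W f.
  apply: contrapT => /forall2NP nW; move: a0; rewrite big1 ?ltxx // => f fa.
  by apply/eqP; case: (nW f) => // /negP; rewrite lt_neqAle W0 andbT negbK eq_sym.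
have pos f : 0 < W f -> forall j, 0 < w (f j).
  move=> Wf j; rewrite lt_neqAle w0 andbT eq_sym; apply: contraTneq Wf => wf0.
  by rewrite /W (bigD1 j) //= wf0 mul0r ltxx.
(* [hsgn] compares only tuples of positive weight; for weight zero both sides vanish. *)
have sgE f : nu f = nu f0 -> sg f * W f = sg f0 * W f.
  move=> nuf; have [->|Wf] := eqVneq (W f) 0; first by rewrite !mulr0.
  congr (_ * _); apply: hsgn => //; last exact: pos.
  by apply: pos; rewrite lt_neqAle eq_sym Wf W0.
(* The tuples of frequency [nu f0] include all those with counts [a]; the additional ones only
   increase the modulus, since all nonzero terms have the sign of [f0]. *)
have Sle : \sum_(f | cnt f == a) W f <= r ^+ N.
  have := coef (nu f0).
  rewrite -rmorph_sum normc_def /= expr0n addr0 sqrtr_sqr lecR.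
  under eq_bigr => f /eqP/sgE -> do [].
  rewrite -mulr_sumr normrM normr_prod big1 ?mul1r; last first.
    by move=> j _; rewrite normrX normrN1 expr1n.
  apply: le_trans; apply: le_trans (ler_norm _).
  rewrite [leRHS]big_mkcond [leLHS]big_mkcond /=; apply: ler_sum => f _.
  case: eqP => [fa|_]; last by case: ifP.
  by rewrite ifT // !nuE fa f0a.
by apply: le_trans ha _; rewrite mulrC card_ffun card_ord natrX ler_wpM2r //.
Qed.

(** * Exponential of a diagonalized matrix, and limit superior at infinity *)

Local Open Scope classical_set_scope.

(** Each entry of a partial sum is a finite combination of scalar partial sums, so the limit can be
    taken eigenvalue by eigenvalue. *)
Lemma expmx_diagonalizable (K : numFieldType) (n : nat) (P : 'M[K]_n.+1)
    (D : 'rV[K]_n.+1) (E : 'I_n.+1 -> K) (u v : 'I_n.+1) :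
  P \in unitmx ->
  (forall r, series (fun k : nat => D 0 r ^+ k / k`!%:R) @ \oo --> E r) ->
  expmx (invmx P *m diag_mx D *m P) u v = \sum_r invmx P u r * E r * P r v.
Proof.
move=> Pu DE; rewrite /expmx mxE.
have powE k : (invmx P *m diag_mx D *m P) ^+ k =
    invmx P *m diag_mx (\row_r D 0 r ^+ k) *m P.
  elim: k => [|k IH].
    have -> : \row_r D 0 r ^+ 0 = const_mx 1 by apply/rowP=> r; rewrite !mxE.
    by rewrite diag_const_mx mulmx1 mulVmx.
  rewrite exprSr IH -mulmxE !mulmxA mulmxK // -!mulmxA; congr (_ *m _).
  rewrite !mulmxA; congr (_ *m _); rewrite mul_diag_mx; apply/matrixP=> i j.
  by rewrite !mxE; case: eqP => [->|_]; rewrite ?mulr1n ?mulr0n ?mulr0 // exprSr.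
rewrite (_ : series _ = (fun N => \sum_r (invmx P u r *
    series (fun k : nat => D 0 r ^+ k / k`!%:R) N) * P r v)); last first.
  apply/funext => N; rewrite /series /=.
  transitivity (\sum_(0 <= k < N) \sum_r invmx P u r * (D 0 r ^+ k / k`!%:R) * P r v).
    apply: eq_bigr => k _; rewrite powE mxE mulr_suml; apply: eq_bigr => r _.
    by rewrite mul_mx_diag !mxE -!mulrA [_ * P r v]mulrC.
  rewrite exchange_big /=; apply: eq_bigr => r _.
  by rewrite -mulr_suml -mulr_sumr.
apply: cvg_lim => //; apply: cvg_big => [|r _]; first exact: add_continuous.
by apply: cvgMl; apply: cvgMr; exact: DE.
Qed.

(** The whole line, as a neighbourhood of infinity, gives the upper bound; every such neighbourhood
    contains a half-line, where [h] comes within any [e] of 1. *)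
Lemma limf_esup_pinfty_eq1 (R : realType) (h : R -> R) :
  (forall t, h t <= 1) -> (forall A r, r < 1 -> exists2 t, A < t & r < h t) ->
  limf_esup (fun t => (h t)%:E) (pinfty_nbhs R) = 1%E.
Proof.
move=> h1 hr; apply/eqP; rewrite eq_le; apply/andP; split.
  apply: le_trans (_ : (ereal_sup ((fun t => (h t)%:E) @` setT) <= _)%E).
    by apply: ereal_inf_lbound; exists setT => //; exact: filterT.
  by apply: ge_ereal_sup => _ [t _ <-]; rewrite lee_fin.
apply: le_ereal_inf_tmp => _ [V [A [_ AV]] <-].
apply/lee_addgt0Pr => e e0.
have [t At et] : exists2 t, A < t & 1 - e < h t by apply: hr; rewrite ltrBlDr ltrDl.
apply: le_trans (_ : ((h t)%:E + e%:E <= _)%E).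
  by rewrite -EFinD lee_fin; lra.
by rewrite leeD2r //; apply: ereal_sup_ubound; exists t => //; exact: AV.
Qed.

Local Close Scope classical_set_scope.

(** * Complex roots and complex eigenvectors of real data *)

Lemma size_complex_roots (R : realType) (p : {poly R}) :
  p \is monic -> size (complex_roots p) = poly_deg p /\
  map_poly (real_complex R) p = \prod_(z <- complex_roots p) ('X - z%:P).
Proof.
move=> pm; rewrite /complex_roots /poly_deg.
case: closed_field_poly_normal => rs /= prs.
have {}prs : map_poly (real_complex R) p = \prod_(z <- rs) ('X - z%:P).
  by rewrite {1}prs lead_coef_map (monicP pm) rmorph1 scale1r.
split=> //; by rewrite -(size_map_poly (real_complex R)) prs size_prod_XsubC.
Qed.

(** Strong cospectrality speaks of real eigenvectors, the spectral theorem of complex ones. The real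
    and imaginary parts of [x] and their sum are eigenvectors for [d] or zero; the sum rules out
    opposite signs for the two parts unless one of them vanishes at [u]. *)
Lemma strongly_cospectral_complex (R : realType) (n : nat) (M : 'M[R]_n.+1)
    (u v : 'I_n.+1) (x : 'rV[R[i]]_n.+1) (d : R) :
  M^T = M -> strongly_cospectral M u v ->
  x *m map_mx (real_complex R) M = d%:C *: x ->
  x 0 u = x 0 v \/ x 0 u = - x 0 v.
Proof.
move=> Msym sc xM.
pose y : 'cV[R]_n.+1 := \col_j complex.Re (x 0 j).
pose z : 'cV[R]_n.+1 := \col_j complex.Im (x 0 j).
have sgn (phi : 'cV[R]_n.+1) : M *m phi = d *: phi ->
    phi u 0 = phi v 0 \/ phi u 0 = - phi v 0.
  move=> Mphi; have [->|phi0] := eqVneq phi 0; first by left; rewrite !mxE.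
  by apply: sc; split=> //; exists d.
have xj j : \sum_k x 0 k * (M k j)%:C = d%:C * x 0 j.
  by have /rowP/(_ j) := xM; rewrite !mxE => <-; apply: eq_bigr => k _; rewrite mxE.
have Mt i j : M i j = M j i by rewrite -[in LHS]Msym mxE.
have My : M *m y = d *: y.
  apply/colP=> j; rewrite !mxE; have /(congr1 (@complex.Re R)) := xj j.
  rewrite raddf_sum /=; case: (x 0 j) => a b /=; rewrite mul0r subr0 => <-.
  apply: eq_bigr => k _; rewrite mxE Mt; case: (x 0 k) => a' b' /=.
  by rewrite mulr0 subr0 mulrC.
have Mz : M *m z = d *: z.
  apply/colP=> j; rewrite !mxE; have /(congr1 (@complex.Im R)) := xj j.
  rewrite raddf_sum /=; case: (x 0 j) => a b /=; rewrite mul0r addr0 => <-.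
  apply: eq_bigr => k _; rewrite mxE Mt; case: (x 0 k) => a' b' /=.
  by rewrite mulr0 add0r mulrC.
have Myz : M *m (y + z) = d *: (y + z) by rewrite mulmxDr My Mz scalerDr.
have := sgn _ My; have := sgn _ Mz; have := sgn _ Myz; rewrite !mxE.
case: (x 0 u) (x 0 v) => a b [a' b'] /= H1 H2 H3.
suff : (a = a' /\ b = b') \/ (a = - a' /\ b = - b').
  by case=> -[-> ->]; [left|right].
by case: H1 H2 H3 => ? [] ? [] ?; (left; split; lra) || (right; split; lra).
Qed.

(** Because x p(M) z = p(d) x z is zero while x z is not, p(d) = 0. *)
Lemma rel_minpoly_root (R : realType) (n : nat) (M : 'M[R]_n.+1)
    (z : 'cV[R]_n.+1) (p : {poly R}) (x : 'rV[R[i]]_n.+1) (d : R[i]) :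
  is_rel_minpoly M z p -> x *m map_mx (real_complex R) M = d *: x ->
  x *m map_mx (real_complex R) z != 0 -> root (map_poly (real_complex R) p) d.
Proof.
move=> [_ pz _] xM xz0; apply/rootP/eqP.
have : x *m map_mx (real_complex R) (horner_mx M p *m z) = 0.
  by rewrite pz map_mx0 mulmx0.
rewrite map_mxM map_horner_mx mulmxA (mulmx_horner_eigen _ xM) -scalemxAl.
by move/eqP; rewrite scaler_eq0 (negPf xz0) orbF.
Qed.

Theorem theorem2p11 (R : realType) (n : nat) (M : 'M[R]_n.+1)
    (S : {pred R}) (F : subFieldType S) (u v : 'I_n.+1)
    (Pplus Pminus : {poly R}) :
  M^T = M ->
  (forall i j : 'I_n.+1, M i j \in S) ->
  u <> v ->
  strongly_cospectral M u v ->
  is_rel_minpoly M (char_vec R u + char_vec R v) Pplus ->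
  is_rel_minpoly M (char_vec R u - char_vec R v) Pminus ->
  irreducible_over F Pplus ->
  irreducible_over F Pminus ->
  poly_trace Pplus / (poly_deg Pplus)%:R
    <> poly_trace Pminus / (poly_deg Pminus)%:R ->
  pgst M u v.
Proof.
move=> Msym MS _ sc minp minm [qp [qpE qpirr]] [qm [qmE qmirr]] mean_neq.
pose Mc := map_mx (real_complex R) M.
have herm : Mc \is hermsymmx.
  apply: realsym_hermsym.
    by apply/is_hermitianmxP; rewrite expr0 scale1r map_mx_id // /Mc map_trmx Msym.
  by apply/mxOverP => i j; rewrite mxE complex_real.
have := orthomx_spectralP (hermitian_normalmx herm).
set P := spectralmx Mc; set D := spectral_diag Mc => McE.
have Punit : P \is unitarymx := spectral_unitarymx Mc.
have Pu : P \in unitmx := unitarymx_unit Punit.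
pose d r := complex.Re (D 0 r).
have dE r : D 0 r = (d r)%:C.
  by rewrite RRe_real //; have /mxOverP := hermitian_spectral_diag_real herm.
have eigP r : row r P *m Mc = (d r)%:C *: row r P.
  have : P *m Mc = diag_mx D *m P by rewrite [X in P *m X]McE -mulmxA mulKVmx.
  move/(congr1 (row r)); rewrite row_mul => ->; rewrite mul_diag_mx -dE.
  by apply/rowP=> j; rewrite !mxE.
(* True selects P_-, false P_+. Where both entries vanish the bit is false, but then the weight
   [w r] is zero. *)
pose b r := P r u != P r v.
have bE r : P r v = (-1) ^+ b r * P r u.
  have := strongly_cospectral_complex Msym sc (eigP r); rewrite !mxE /b.
  case: eqVneq => [-> _|neq [/eqP|->]]; rewrite ?mul1r ?(negPf neq) //.
  by rewrite expr1 mulrN mulN1r opprK.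
pose w r := complex.Re (`|P r u| ^+ 2).
have wE r : (w r)%:C = P r u * (P r u)^*.
  by rewrite RRe_real ?ger0_real ?exprn_ge0 // normCK.
have invP r : invmx P u r = (P r u)^* by rewrite invmx_unitary // !mxE.
have w_ge0 r : 0 <= w r by rewrite -lecR RRe_real ?exprn_ge0 // ger0_real // exprn_ge0.
have sumw : \sum_r w r = 1.
  apply: complexI; rewrite rmorph_sum /=.
  transitivity ((invmx P *m P) u u); last by rewrite mulVmx // mxE eqxx.
  by rewrite mxE; apply: eq_bigr => r _; rewrite wE invP mulrC.
have UE t : transition_mx M t u v = \sum_r ((-1) ^+ b r * w r)%:C * cis (d r * t).
  rewrite /transition_mx.
  have -> : ('i%C * t%:C) *: Mc = invmx P *m diag_mx (('i%C * t%:C) *: D) *m P.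
    by rewrite linearZ /= -scalemxAr -scalemxAl -McE.
  rewrite (@expmx_diagonalizable _ _ _ _ (fun r => cis (d r * t))) //.
    apply: eq_bigr => r _; rewrite bE invP rmorphM /= wE rmorphXn rmorphN1.
    rewrite mulrACA [_ * (-1) ^+ _]mulrC [_ * P r u]mulrC mulrACA.
    by rewrite !mulrA.
  move=> r; rewrite mxE dE -mulrA -rmorphM [t * _]mulrC; exact: cvg_series_cis.
have monicp : Pplus \is monic by case: minp.
have monicm : Pminus \is monic by case: minm.
have [szp rsp] := size_complex_roots monicp.
have [szm rsm] := size_complex_roots monicm.
have root_b r : 0 < w r ->
    root (map_poly (real_complex R) (if b r then Pminus else Pplus)) (d r)%:C.
  move=> wr; have Pru : P r u != 0.
    by apply: contraTneq wr => Pru0; rewrite /w Pru0 normr0 expr0n ltxx.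
  have P2 : P r u + P r u != 0 by rewrite -mulr2n mulrn_eq0.
  (* The scalar [c] treats e_u + e_v and e_u - e_v at once; by [bE] the sign matching [b r] yields
     twice [P r u], which is nonzero. *)
  have eigPz (c : R) : (row r P *m map_mx (real_complex R)
      (char_vec R u + c *: char_vec R v)) 0 0 = P r u + c%:C * P r v.
    by rewrite map_mxD map_mxZ mulmxDr -scalemxAr /char_vec !map_delta_mx -!colE !mxE.
  have [br|br] := boolP (b r); [apply: (rel_minpoly_root minm) (eigP r) _
                              |apply: (rel_minpoly_root minp) (eigP r) _].
    apply: contra P2 => /eqP/matrixP/(_ 0 0).
    by rewrite -[X in _ + X]scaleN1r eigPz bE br mxE rmorphN1 !mulN1r opprK => ->.
  apply: contra P2 => /eqP/matrixP/(_ 0 0).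
  by rewrite -[char_vec R v]scale1r eigPz bE (negPf br) mxE rmorph1 !mul1r => ->.
have hsgn N (f g : 'I_N -> 'I_n.+1) :
    (forall j, 0 < w (f j)) -> (forall j, 0 < w (g j)) ->
    \sum_j d (f j) = \sum_j d (g j) ->
    \prod_j (-1) ^+ b (f j) = \prod_j (-1) ^+ b (g j) :> R.
  move=> wf wg dfg.
  (* Both tuples form one family over a disjoint union, all of whose members have positive weight,
     so that [root_b] applies to each. *)
  pose h (x : 'I_N + 'I_N) := match x with inl j => f j | inr j => g j end.
  have wh x : 0 < w (h x) by case: x.
  pose iota : {rmorphism F -> R[i]} := real_complex R \o (val : F -> R).
  (* [M] descends to [F]; all entries lie in [S], so the default 0 of [insubd] never occurs. *)
  pose M0 : 'M[F]_n.+1 := \matrix_(i, j) insubd 0 (M i j).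
  have M0E : map_mx iota M0 = Mc.
    by apply/matrixP=> i j; rewrite !mxE /= insubdK.
  pose q x := if b (h x) then qm else qp.
  pose rs x := complex_roots (if b (h x) then Pminus else Pplus).
  have qE x : map_poly iota (q x) = map_poly (real_complex R)
      (if b (h x) then Pminus else Pplus).
    by rewrite map_poly_comp /q; case: (b _); rewrite ?qpE ?qmE.
  have valm (p : {poly F}) : map_poly (val : F -> R) p \is monic -> p \is monic.
    by rewrite map_monic.
  have : \sum_j (\sum_(z <- rs (inl j)) z) / (size (rs (inl j)))%:R =
      \sum_j (\sum_(z <- rs (inr j)) z) / (size (rs (inr j)))%:R.
    apply: (@eigenvalue_sum_mean F _ iota _ M0 _ (fun x => (d (h x))%:C) q rs).
    - move=> x; rewrite M0E; apply/eigenvalueP; exists (row (h x) P) => //.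
      apply: contraTneq (wh x) => rP0; rewrite /w.
      have /rowP/(_ u) := rP0; rewrite !mxE => ->.
      by rewrite normr0 expr0n ltxx.
    - move=> x; rewrite /q; case: (b _); split=> //; apply: valm.
        by rewrite -[map_poly _ _]qmE.
      by rewrite -[map_poly _ _]qpE.
    - by move=> x; rewrite qE; exact: root_b.
    - by move=> x; rewrite qE /rs; case: (b _).
    - by rewrite -!rmorph_sum /h dfg.
  pose mp := poly_trace Pplus / (poly_deg Pplus)%:R.
  pose mm := poly_trace Pminus / (poly_deg Pminus)%:R.
  (* The mean is affine in the bit with nonzero slope, so equal sums of means force equally many
     true bits. *)
  have meanE x : (\sum_(z <- rs x) z) / (size (rs x))%:R =
      mp + (b (h x))%:R * (mm - mp).
    rewrite /rs; case: (b _); rewrite ?szp ?szm /= ?mul1r ?mul0r ?addr0 //.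
    by rewrite addrC subrK.
  move=> sum_mean.
  have {sum_mean} : \sum_j (mp + (b (f j))%:R * (mm - mp)) =
      \sum_j (mp + (b (g j))%:R * (mm - mp)).
    apply: etrans (etrans _ sum_mean) _; apply: eq_bigr => j _.
      by rewrite (meanE (inl j)).
    by rewrite (meanE (inr j)).
  rewrite !big_split /= => /addrI; rewrite -!mulr_suml => /mulIf eqb.
  have {eqb} : (\sum_j b (f j) = \sum_j b (g j))%N.
    apply/eqP; rewrite -(eqr_nat R[i]) !natr_sum; apply/eqP/eqb.
    by rewrite subr_eq0 eq_sym; apply/eqP.
  by rewrite -!expr_sum => ->.
have normcE (x : R[i]) : (Normc.normc x)%:C = `|x| by [].
rewrite /pgst; apply: limf_esup_pinfty_eq1 => [t|A r r1].
  rewrite -lecR UE normcE; apply: le_trans (ler_norm_sum _ _ _) _.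
  rewrite -[X in _ <= X%:C]sumw rmorph_sum; apply: ler_sum => r _.
  rewrite normrM norm_cis mulr1 normc_def /= expr0n addr0 sqrtr_sqr lecR.
  by rewrite normrMsign ger0_norm.
have [t At rt] := signed_exp_sum_near1 w_ge0 sumw hsgn A r1.
by exists t => //; rewrite -ltcR normcE UE.
Qed.
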